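(* Let $n\ge 1$. Let the data $\bar U^{n-1}=(U^{n-1,k})_{0\le k\le N_t}$, $\bar M^{n-1}=(M^{n-1,k})_{0\le k\le N_t}$ with $U^{n-1,k},M^{n-1,k}\in\mathbb{R}^{N_h^2}$, and the discrete drift $(Q^{n,k})_{0\le k\le N_t-1}$ be given, and let $\mathbf A,\mathbf W,\mathbf Z,\mathbf B,\mathbf C$ be the block matrices and block vectors built from these data as described in the context. Assume that $F'>0$ and that $\bar M^{n-1}>0$ (all entries are strictly positive). Then there exists a unique solution $(\bar U^n,\bar M^n)\in\mathbb{R}^{(N_t+1)N_h^2}\times\mathbb{R}^{(N_t+1)N_h^2}$ of the linear system $$ \begin{bmatrix}\mathbf A & -\mathbf W\\ -\mathbf Z & \mathbf A^{\top}\end{bmatrix} \begin{bmatrix}\bar U^n\\ \bar M^n\end{bmatrix}=\begin{bmatrix}\mathbf B\\ \mathbf C\end{bmatrix}. $$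
   Context: This linear system is one step of a semi-Lagrangian discretization of Newton's iteration for a second-order mean field game on the torus $\mathbb{T}^2=\mathbb{R}^2/\mathbb{Z}^2$ with Hamiltonian $H(x,p)=|p|^2/2-V(x)$, $V$ a bounded potential, local coupling $F$ (a real function, differentiable on $(0,\infty)$; $F'>0$ means $F'(s)>0$ for all $s>0$), terminal cost $G:\mathbb{T}^2\to\mathbb{R}$, initial density $m_0:\mathbb{T}^2\to\mathbb{R}$, diffusion $\nu>0$, $\sigma=\sqrt{2\nu}$, and horizon $T>0$. Grid. $N_t,N_h$ are positive integers, $\Delta t=T/N_t$, $h=1/N_h$, $x_{i,j}=(ih,jh)$ for $i,j\in\{0,\dots,N_h-1\}$, and $\mathcal G_h$ is the set of these points. Indices $i,j$ are understood modulo $N_h$ (periodicity). A grid function $v=(v_{i,j})$ is identified with the vector in $\mathbb{R}^{N_h^2}$ whose entry number $i+N_hj$ is $v_{i,j}$; functions such as $F,F'$ act entrywise on vectors. Difference operators. $(D_1v)_{i,j}=\frac{v_{i+1,j}-v_{i-1,j}}{2h}$, $(D_2v)_{i,j}=\frac{v_{i,j+1}-v_{i,j-1}}{2h}$, viewed as $N_h^2\times N_h^2$ matrices; $D_hv=(D_1v,D_2v)$ and $\mathrm{div}_h(p_1,p_2)=D_1p_1+D_2p_2$. Interpolation. $(\beta_{p,q})_{0\le p,q\le N_h-1}$ is the nodal piecewise linear finite element basis on $\mathbb{T}^2$ associated with the grid $\mathcal G_h$ (so $\beta_{p,q}\ge0$, $\sum_{p,q}\beta_{p,q}\equiv1$,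 and $\beta_{p,q}$ equals $1$ at $x_{p,q}$ and $0$ at the other grid points). Data. $q^{n,k}_{i,j}\in\mathbb{R}^2$ ($0\le k\le N_t-1$) are given; $Q^{n,k}$ denotes the collection $(q^{n,k}_{i,j})_{i,j}$. $U^{N_t}$ and $M^0$ are the vectors with entries $G(x_{i,j})$ and $m_0(x_{i,j})$. Matrices and vectors for $0\le k\le N_t-1$: - $\mathcal A^k=\mathcal A(Q^{n,k})$ is the $N_h^2\times N_h^2$ matrix whose entry in row $(i,j)$ and column $(p,q)$ is $\frac14\sum_{\ell=1}^4\beta_{p,q}\big(y^\ell(x_{i,j},q^{n,k}_{i,j})\big)$, where $y^\ell(x,q)$ is the class in $\mathbb{T}^2$ of $x+\Delta t\,q+\sqrt{2\Delta t}\,\sigma e^\ell$ and $e^1,\dots,e^4$ are the vectors $(\pm1,0),(0,\pm1)$. - $\mathcal W^k=\mathrm{diag}(F'(M^{n-1,k}))$. - $\mathcal B^k\in\mathbb{R}^{N_h^2}$ has entries $\frac{|q^{n,k}_{i,j}|^2}{2}+V(x_{i,j})+F(M^{n-1,k}_{i+N_hj})-F'(M^{n-1,k}_{i+N_hj})M^{n-1,k}_{i+N_hj}$. - $\mathcal Z^{k+1}$ is the $N_h^2\times N_h^2$ matrix defined by $\mathcal Z^{k+1}v=\mathrm{div}_h\big(\mathrm{diag}(M^{n-1,k+1})D_hv\big)=\sum_{r=1}^2D_r\,\mathrm{diag}(M^{n-1,k+1})\,D_rv$ for $v\in\mathbb{R}^{N_h^2}$. - $\mathcal C^{k+1}=-\mathcal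 Z^{k+1}U^{n-1,k+1}$. Block objects (blocks numbered $0,\dots,N_t$, each of size $N_h^2$; $\mathcal I$ is the identity and $\mathcal O$ the zero block). $\bar U^n=(U^{n,0},\dots,U^{n,N_t})$, $\bar M^n=(M^{n,0},\dots,M^{n,N_t})$. $\mathbf A$ is block upper bidiagonal with diagonal blocks $\mathcal I$ and block $-\mathcal A^k$ in position $(k,k+1)$, $0\le k\le N_t-1$. $\mathbf W=\Delta t\,\mathrm{blockdiag}(\mathcal W^0,\dots,\mathcal W^{N_t-1},\mathcal O)$. $\mathbf Z=\Delta t\,\mathrm{blockdiag}(\mathcal O,\mathcal Z^1,\dots,\mathcal Z^{N_t})$. $\mathbf B=(\Delta t\,\mathcal B^0,\dots,\Delta t\,\mathcal B^{N_t-1},U^{N_t})$ and $\mathbf C=(M^0,\Delta t\,\mathcal C^1,\dots,\Delta t\,\mathcal C^{N_t})$. *)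

(* Defs.v *)
From HB Require Import structures.
From mathcomp Require Import all_boot all_order all_algebra.
From mathcomp Require Import all_classical all_reals all_analysis.

Set Implicit Arguments.
Unset Strict Implicit.
Unset Printing Implicit Defensive.

Import Order.TTheory GRing.Theory Num.Theory.
Import numFieldNormedType.Exports.

Local Open Scope classical_set_scope.
Local Open Scope ring_scope.

(* A function on T^2 = R^2/Z^2 is a Z^2-periodic function on R^2; evaluating
   it at the class of a point is evaluating it at the point. *)
Definition on_torus (R : realType) (f : R * R -> R) : Prop :=
  periodic f (1, 0) /\ periodic f (0, 1).

Section grid.
Context {R : realType} (N : nat).

Definition mesh : R := N%:R^-1.

Definition lattice_point (i j : int) : R * R := (i%:~R * mesh, j%:~R * mesh).

Definition grid_point (i j : 'I_N) : R * R := lattice_point i j.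

Fact gidx_subproof (i j : 'I_N) : (i + N * j < N ^ 2)%N.
Proof.
rewrite -mulnn; apply: (@leq_trans (N + N * j)); first by rewrite ltn_add2r.
by rewrite -mulnS leq_mul.
Qed.

Definition gidx (i j : 'I_N) : 'I_(N ^ 2) := Ordinal (gidx_subproof i j).

Fact gpos (k : 'I_(N ^ 2)) : (0 < N)%N.
Proof. by case: N k => [[]|]. Qed.

Fact gidx2_subproof (k : 'I_(N ^ 2)) : (k %/ N < N)%N.
Proof. by rewrite ltn_divLR ?(gpos k) // mulnn. Qed.

(* The coordinates (i, j) of the entry number k = i + N j. *)
Definition gidx1 (k : 'I_(N ^ 2)) : 'I_N := Ordinal (ltn_pmod k (gpos k)).
Definition gidx2 (k : 'I_(N ^ 2)) : 'I_N := Ordinal (gidx2_subproof k).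

Lemma gidxK (k : 'I_(N ^ 2)) : gidx (gidx1 k) (gidx2 k) = k.
Proof. by apply: val_inj => /=; rewrite addnC mulnC -divn_eq. Qed.

Lemma gidx1K (i j : 'I_N) : gidx1 (gidx i j) = i.
Proof. by apply: val_inj => /=; rewrite mulnC addnC modnMDl modn_small. Qed.

Lemma gidx2K (i j : 'I_N) : gidx2 (gidx i j) = j.
Proof.
apply: val_inj => /=.
by rewrite mulnC addnC divnMDl ?(gpos (gidx i j)) // divn_small ?addn0.
Qed.

(* ordS and ord_pred are the successor and predecessor modulo N. *)
Definition D1 : 'M[R]_(N ^ 2) :=
  \matrix_(r, c)
    (((c == gidx (ordS (gidx1 r)) (gidx2 r))%:R
      - (c == gidx (ord_pred (gidx1 r)) (gidx2 r))%:R) / (2 * mesh)).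

Definition D2 : 'M[R]_(N ^ 2) :=
  \matrix_(r, c)
    (((c == gidx (gidx1 r) (ordS (gidx2 r)))%:R
      - (c == gidx (gidx1 r) (ord_pred (gidx2 r)))%:R) / (2 * mesh)).

Let sum_pick (v : 'cV[R]_(N ^ 2)) a b :
  \sum_c ((c == a)%:R - (c == b)%:R) / (2 * mesh) * v c 0
  = (v a 0 - v b 0) / (2 * mesh).
Proof.
under eq_bigr do rewrite mulrAC mulrBl.
rewrite -mulr_suml sumrB; congr ((_ - _) / _).
  by rewrite (bigD1 a) //= eqxx mul1r big1 ?addr0 // => c /negPf ->;
     rewrite mul0r.
by rewrite (bigD1 b) //= eqxx mul1r big1 ?addr0 // => c /negPf ->;
   rewrite mul0r.
Qed.

Lemma D1E (v : 'cV[R]_(N ^ 2)) i j :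
  (D1 *m v) (gidx i j) 0
  = (v (gidx (ordS i) j) 0 - v (gidx (ord_pred i) j) 0) / (2 * mesh).
Proof.
rewrite mxE -sum_pick; apply: eq_bigr => c _.
by rewrite mxE gidx1K gidx2K.
Qed.

Lemma D2E (v : 'cV[R]_(N ^ 2)) i j :
  (D2 *m v) (gidx i j) 0
  = (v (gidx i (ordS j)) 0 - v (gidx i (ord_pred j)) 0) / (2 * mesh).
Proof.
rewrite mxE -sum_pick; apply: eq_bigr => c _.
by rewrite mxE gidx1K gidx2K.
Qed.

Definition sample (f : R * R -> R) : 'cV[R]_(N ^ 2) :=
  \col_r f (grid_point (gidx1 r) (gidx2 r)).

End grid.

Arguments mesh R N : clear implicits.
Arguments D1 R N : clear implicits.
Arguments D2 R N : clear implicits.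

Section finite_elements.
Context {R : realType}.

Definition conv_hull (s : seq (R * R)) : set (R * R) :=
  [set x | exists w : R * R -> R,
     [/\ forall v, 0 <= w v, \sum_(v <- s) w v = 1
       & x = \sum_(v <- s) w v *: v]].

Definition nondegenerate (t : 3.-tuple (R * R)) : Prop :=
  let a := tnth t 1 - tnth t 0 in
  let b := tnth t (inord 2) - tnth t 0 in
  a.1 * b.2 - a.2 * b.1 != 0.

(* A triangulation of T^2 with vertex set the grid, lifted to R^2: a
   Z^2-periodic conforming triangulation of R^2 with vertex set (h Z)^2.
   Stating it in R^2 also covers N = 1, 2, where distinct vertices of a
   triangle may coincide in T^2. *)
Definition grid_triangulation (N : nat) (Tri : set (3.-tuple (R * R))) : Prop :=
  [/\ forall t, Tri t -> nondegenerate t,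
      [set v | exists2 t, Tri t & v \in t]
        = [set v | exists i j : int, v = lattice_point N i j],
      forall x, exists2 t, Tri t & conv_hull t x,
      forall t t', Tri t -> Tri t' ->
        conv_hull t `&` conv_hull t' `<=` conv_hull [seq v <- t | v \in t']
    & forall t (a b : int), Tri t ->
        Tri [tuple of map (+%R (a%:~R, b%:~R)) t] ].

Definition affine_on (A : set (R * R)) (f : R * R -> R) : Prop :=
  exists a b c : R, forall x, A x -> f x = a + b * x.1 + c * x.2.

(* These conditions determine beta: a point of the plane lies in some
   triangle, and beta p q is affine there with prescribed vertex values. *)
Definition nodal_P1_basis (N : nat) (Tri : set (3.-tuple (R * R)))
    (beta : 'I_N -> 'I_N -> R * R -> R) : Prop :=
  forall p q : 'I_N,
    [/\ on_torus (beta p q),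
        forall t, Tri t -> affine_on (conv_hull t) (beta p q)
      & forall i j : 'I_N,
          beta p q (grid_point i j) = ((i == p) && (j == q))%:R ].

End finite_elements.

Section blocks.
Context {R : realType} (N : nat).

Definition directions : seq (R * R) :=
  [:: (1, 0); (-1, 0); (0, 1); (0, -1)].

Definition foot (dt sigma : R) (e x q : R * R) : R * R :=
  x + dt *: q + (Num.sqrt (2 * dt) * sigma) *: e.

Definition calA (beta : 'I_N -> 'I_N -> R * R -> R) (dt sigma : R)
    (q : 'I_N -> 'I_N -> R * R) : 'M[R]_(N ^ 2) :=
  \matrix_(r, c)
    (4^-1 * \sum_(e <- directions)
       beta (gidx1 c) (gidx2 c)
         (foot dt sigma e (grid_point (gidx1 r) (gidx2 r))
            (q (gidx1 r) (gidx2 r)))).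

Definition calW (F : R -> R) (M : 'cV[R]_(N ^ 2)) : 'M[R]_(N ^ 2) :=
  diag_mx (map_mx (derive1 F) M)^T.

Definition calB (F : R -> R) (V : R * R -> R) (q : 'I_N -> 'I_N -> R * R)
    (M : 'cV[R]_(N ^ 2)) : 'cV[R]_(N ^ 2) :=
  \col_r
    (((q (gidx1 r) (gidx2 r)).1 ^+ 2 + (q (gidx1 r) (gidx2 r)).2 ^+ 2) / 2
     + V (grid_point (gidx1 r) (gidx2 r))
     + F (M r 0) - derive1 F (M r 0) * M r 0).

Definition calZ (M : 'cV[R]_(N ^ 2)) : 'M[R]_(N ^ 2) :=
  D1 R N *m diag_mx M^T *m D1 R N + D2 R N *m diag_mx M^T *m D2 R N.

Definition calC (U M : 'cV[R]_(N ^ 2)) : 'cV[R]_(N ^ 2) := - (calZ M *m U).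

(* Blocks are numbered by 'I_Nt.+1 and time steps by 'I_Nt. The step k is the
   block lift ord_max k (same value), the next block k + 1 is lift ord0 k;
   unlift ord_max a is None exactly when a is the last block. *)
Context (Nt : nat).

Definition blk_dim : nat := \sum_(a < Nt.+1) (N ^ 2)%N.

Definition bfA (beta : 'I_N -> 'I_N -> R * R -> R) (dt sigma : R)
    (Q : 'I_Nt -> 'I_N -> 'I_N -> R * R) : 'M[R]_blk_dim :=
  \mxblock_(a < Nt.+1, b < Nt.+1)
    (if a == b then 1%:M
     else if unlift ord_max a is Some k
          then if b == lift ord0 k then - calA beta dt sigma (Q k) else 0
          else 0 : 'M[R]_(N ^ 2)).

Definition bfW (F : R -> R) (dt : R) (M : 'I_Nt.+1 -> 'cV[R]_(N ^ 2)) :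
    'M[R]_blk_dim :=
  dt *: \mxdiag_(a < Nt.+1)
    (if a == ord_max then 0 else calW F (M a) : 'M[R]_(N ^ 2)).

Definition bfZ (dt : R) (M : 'I_Nt.+1 -> 'cV[R]_(N ^ 2)) : 'M[R]_blk_dim :=
  dt *: \mxdiag_(a < Nt.+1)
    (if a == ord0 then 0 else calZ (M a) : 'M[R]_(N ^ 2)).

Definition bfB (F : R -> R) (V G : R * R -> R) (dt : R)
    (Q : 'I_Nt -> 'I_N -> 'I_N -> R * R) (M : 'I_Nt.+1 -> 'cV[R]_(N ^ 2)) :
    'cV[R]_blk_dim :=
  \mxcol_(a < Nt.+1)
    (if unlift ord_max a is Some k then dt *: calB F V (Q k) (M a)
     else sample N G : 'cV[R]_(N ^ 2)).

Definition bfC (m0 : R * R -> R) (dt : R) (U M : 'I_Nt.+1 -> 'cV[R]_(N ^ 2)) :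
    'cV[R]_blk_dim :=
  \mxcol_(a < Nt.+1)
    (if a == ord0 then sample N m0
     else dt *: calC (U a) (M a) : 'cV[R]_(N ^ 2)).

End blocks.

(* Main.v *)
(* If (x, y) is in the kernel then A x = W y and A^T y = Z x, so
   y^T W y = y^T A x = x^T Z x. The discrete derivatives are skew-symmetric and
   the densities positive, hence Z is negative semidefinite, while W is diagonal
   with nonnegative entries. So both sides vanish and W y = 0; then A x = 0, so
   x = 0, and A^T y = 0, so y = 0, since A is block unitriangular. *)
Require Import Defs.
From HB Require Import structures.
From mathcomp Require Import all_boot all_order all_algebra.
From mathcomp Require Import all_classical all_reals all_analysis.
Import Order.TTheory GRing.Theory Num.Theory.
Import numFieldNormedType.Exports.
Local Open Scope classical_set_scope.
Local Open Scope ring_scope.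

(** The condition on [W] holds for every symmetric positive semidefinite matrix, so a singular [W]
    such as [bfW], whose last block is zero, is allowed. *)
Lemma saddle_unitmx (R : realFieldType) (n : nat) (A W Z : 'M[R]_n) :
    A \in unitmx ->
    (forall y : 'cV[R]_n, (y^T *m W *m y) 0 0 <= 0 -> W *m y = 0) ->
    (forall x : 'cV[R]_n, (x^T *m Z *m x) 0 0 <= 0) ->
  block_mx A (- W) (- Z) A^T \in unitmx.
Proof.
(* Row freeness concerns left kernels; passing to the transpose turns it into a statement about
   column vectors killed by the block matrix. *)
move=> uA hW hZ; rewrite -unitmx_tr -row_free_unit.
apply: inj_row_free => v hv; apply: trmx_inj; rewrite trmx0.
have : block_mx A (- W) (- Z) A^T *m v^T = 0.
  by apply: trmx_inj; rewrite trmx_mul trmxK hv trmx0.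
rewrite -[v^T]vsubmxK; move: (usubmx v^T) (dsubmx v^T) => x y.
rewrite mul_block_col !mulNmx => h0.
have [hx hy] : A *m x - W *m y = 0 /\ - (Z *m x) + A^T *m y = 0.
  by apply: eq_col_mx; rewrite h0 col_mx0.
have Ax : A *m x = W *m y by apply/eqP; rewrite -subr_eq0 hx.
have Ay : A^T *m y = Z *m x by apply/eqP; rewrite -subr_eq0 addrC hy.
have Wy0 : W *m y = 0.
  apply: hW; rewrite -mulmxA -Ax.
  (* With [A^T *m y] replacing [Z *m x], both sides are transposes of each other's factors; the
     entry at (0, 0) does not see the outer transpose. *)
  have -> : y^T *m (A *m x) = (x^T *m Z *m x)^T.
    by rewrite -mulmxA -Ay !trmx_mul !trmxK mulmxA.
  by rewrite mxE hZ.
have x0 : x = 0 by rewrite -(mulKmx uA x) Ax Wy0 mulmx0.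
have y0 : y = 0.
  by rewrite -(mulKmx (_ : A^T \in unitmx) y) ?unitmx_tr// Ay x0 !mulmx0.
by rewrite x0 y0 col_mx0.
Qed.

Lemma diag_mx_form (R : comPzRingType) (n : nat) (w : 'rV[R]_n) (x : 'cV[R]_n) :
  (x^T *m diag_mx w *m x) 0 0 = \sum_i w 0 i * x i 0 ^+ 2.
Proof.
rewrite mul_mx_diag mxE; apply: eq_bigr => i _.
by rewrite !mxE mulrAC -expr2 mulrC.
Qed.

Lemma diag_mx_form_ge0 (R : realDomainType) (n : nat)
    (w : 'rV[R]_n) (x : 'cV[R]_n) :
  (forall i, 0 <= w 0 i) -> 0 <= (x^T *m diag_mx w *m x) 0 0.
Proof.
by move=> w0; rewrite diag_mx_form sumr_ge0 // => i _; rewrite mulr_ge0 ?sqr_ge0.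
Qed.

(** In a zero sum of nonnegative terms each [w 0 i * x i 0 ^+ 2] vanishes, so one of [w 0 i],
    [x i 0] is zero and so is their product. *)
Lemma diag_mx_form_eq0 (R : realDomainType) (n : nat)
    (w : 'rV[R]_n) (x : 'cV[R]_n) :
    (forall i, 0 <= w 0 i) ->
  (x^T *m diag_mx w *m x) 0 0 = 0 -> diag_mx w *m x = 0.
Proof.
move=> w0; rewrite diag_mx_form => /eqP.
rewrite psumr_eq0 => [/allP h|i _]; last by rewrite mulr_ge0 ?sqr_ge0.
apply/matrixP => i j; rewrite mul_diag_mx ord1 !mxE.
have := h i (mem_index_enum i); rewrite mulf_eq0 sqrf_eq0 => /= /orP[]/eqP->.
  by rewrite mul0r.
by rewrite mulr0.
Qed.

Lemma mxdiag_form (R : pzRingType) (p : nat) (p_ : 'I_p -> nat)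
    (B : forall i, 'M[R]_(p_ i)) (x : 'cV[R]_(\sum_i p_ i)) :
  (x^T *m mxdiag B *m x) 0 0
  = \sum_i ((submxcol x i)^T *m B i *m submxcol x i) 0 0.
Proof.
rewrite -{1 2}[x]submxcolK tr_mxcol mul_mxrow_mxdiag mul_mxrow_mxcol.
by rewrite summxE.
Qed.

Lemma mxdiag_form_le0 (R : realDomainType) (p : nat) (p_ : 'I_p -> nat)
    (B : forall i, 'M[R]_(p_ i)) (x : 'cV[R]_(\sum_i p_ i)) :
    (forall i (z : 'cV[R]_(p_ i)), (z^T *m B i *m z) 0 0 <= 0) ->
  (x^T *m mxdiag B *m x) 0 0 <= 0.
Proof. by move=> h; rewrite mxdiag_form sumr_le0. Qed.

(** The form is a sum of nonnegative block forms, so being at most zero forces every block form to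
    vanish. *)
Lemma mxdiag_form_eq0 (R : realDomainType) (p : nat) (p_ : 'I_p -> nat)
    (B : forall i, 'M[R]_(p_ i)) (x : 'cV[R]_(\sum_i p_ i)) :
    (forall i (z : 'cV[R]_(p_ i)), 0 <= (z^T *m B i *m z) 0 0) ->
    (forall i (z : 'cV[R]_(p_ i)), (z^T *m B i *m z) 0 0 = 0 -> B i *m z = 0) ->
  (x^T *m mxdiag B *m x) 0 0 <= 0 -> mxdiag B *m x = 0.
Proof.
move=> B_ge0 B_eq0; rewrite mxdiag_form => x_le0.
have /eqP : \sum_i ((submxcol x i)^T *m B i *m submxcol x i) 0 0 = 0.
  by apply/eqP; rewrite eq_le x_le0 sumr_ge0.
rewrite psumr_eq0 => [/allP h|i _]; last exact: B_ge0.
rewrite -[x]submxcolK mul_mxdiag_mxcol -[RHS]mxcol0; apply: eq_mxcol => i.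
by apply: B_eq0; apply/eqP; exact: (h i (mem_index_enum i)).
Qed.

(** One node is the successor of another iff the latter is its predecessor, so transposition swaps
    the two indicators of the centred difference. *)
Lemma D1_tr (R : realType) (N : nat) : (D1 R N)^T = - D1 R N.
Proof.
have shift (r c : 'I_(N ^ 2)) :
    (r == gidx (ordS (gidx1 c)) (gidx2 c))
    = (c == gidx (ord_pred (gidx1 r)) (gidx2 r)).
  by apply/eqP/eqP => ->; rewrite gidx1K gidx2K ?ordSK ?ord_predK gidxK.
by apply/matrixP => r c; rewrite !mxE (shift r c) -(shift c r) -mulNr opprB.
Qed.

Lemma D2_tr (R : realType) (N : nat) : (D2 R N)^T = - D2 R N.
Proof.
have shift (r c : 'I_(N ^ 2)) :
    (r == gidx (gidx1 c) (ordS (gidx2 c)))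
    = (c == gidx (gidx1 r) (ord_pred (gidx2 r))).
  by apply/eqP/eqP => ->; rewrite gidx1K gidx2K ?ordSK ?ord_predK gidxK.
by apply/matrixP => r c; rewrite !mxE (shift r c) -(shift c r) -mulNr opprB.
Qed.

(** Discrete integration by parts: skew-symmetry moves one [D] onto the left factor and yields minus
    a weighted sum of squares of [D *m x]. *)
Lemma skew_diag_form_le0 (R : realDomainType) (n : nat)
    (D : 'M[R]_n) (w : 'rV[R]_n) (x : 'cV[R]_n) :
  D^T = - D -> (forall i, 0 <= w 0 i) ->
  (x^T *m (D *m diag_mx w *m D) *m x) 0 0 <= 0.
Proof.
move=> skewD w0.
have -> : x^T *m (D *m diag_mx w *m D) *m x
          = - ((D *m x)^T *m diag_mx w *m (D *m x)).
  by rewrite trmx_mul skewD mulmxN !mulNmx opprK !mulmxA.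
by rewrite mxE oppr_le0 diag_mx_form_ge0.
Qed.

Lemma calZ_form_le0 (R : realType) (N : nat) (M x : 'cV[R]_(N ^ 2)) :
  (forall r, 0 <= M r 0) -> (x^T *m calZ M *m x) 0 0 <= 0.
Proof.
move=> M0; have MT0 i : 0 <= M^T 0 i by rewrite mxE.
rewrite /calZ mulmxDr mulmxDl mxE.
by rewrite -[leRHS]addr0 lerD // skew_diag_form_le0 // (D1_tr, D2_tr).
Qed.

Lemma bfA_unitmx (R : realType) (N Nt : nat)
    (beta : 'I_N -> 'I_N -> R * R -> R) (dt sigma : R)
    (Q : 'I_Nt -> 'I_N -> 'I_N -> R * R) :
  bfA beta dt sigma Q \in unitmx.
Proof.
(* [det_trig] is about lower triangular matrices, whereas [bfA] is upper triangular, hence the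
   transpose. *)
rewrite -unitmx_tr unitmxE /bfA tr_mxblock det_trig; last first.
  apply/is_trig_mxblockP; split=> [a b ltab|a]; last first.
    by rewrite eqxx trmx1 scalar_mx_is_trig.
  rewrite ifN_eqC; last by rewrite neq_ltn ltab.
  case: unliftP => [k bk|_]; last by rewrite trmx0.
  (* Here [b] has value [k], so [a == lift ord0 k] would make [a] the block after [b], against
     [a < b]. *)
  rewrite ifN ?trmx0 //; apply: contraTneq ltab => ->.
  by rewrite bk lift0 lift_max -leqNgt leqW.
by rewrite big1 ?unitr1 // => s _; rewrite !mxE eqxx !mxE eqxx.
Qed.

Lemma bfW_form_eq0 (R : realType) (N Nt : nat) (F : R -> R) (dt : R)
    (M : 'I_Nt.+1 -> 'cV[R]_(N ^ 2)) (y : 'cV[R]_(blk_dim N Nt)) :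
    0 < dt -> (forall a r, 0 <= derive1 F (M a r 0)) ->
  (y^T *m bfW F dt M *m y) 0 0 <= 0 -> bfW F dt M *m y = 0.
Proof.
move=> dt0 F0; rewrite /bfW -scalemxAr -!scalemxAl mxE pmulr_rle0 // => y_le0.
(* Both blockwise conditions are checked first on the zero last block, then on [calW]. *)
rewrite mxdiag_form_eq0 ?scaler0 // => a z; case: eqP => _.
- by rewrite mulmx0 mul0mx mxE.
- by rewrite diag_mx_form_ge0 // => r; rewrite !mxE.
- by rewrite mul0mx.
- by apply: diag_mx_form_eq0 => r; rewrite !mxE.
Qed.

Lemma bfZ_form_le0 (R : realType) (N Nt : nat) (dt : R)
    (M : 'I_Nt.+1 -> 'cV[R]_(N ^ 2)) (x : 'cV[R]_(blk_dim N Nt)) :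
    0 <= dt -> (forall a r, 0 <= M a r 0) ->
  (x^T *m bfZ dt M *m x) 0 0 <= 0.
Proof.
move=> dt0 M0; rewrite /bfZ -scalemxAr -!scalemxAl mxE mulr_ge0_le0 //.
apply: mxdiag_form_le0 => a z; case: eqP => _; last exact: calZ_form_le0.
by rewrite mulmx0 mul0mx mxE.
Qed.

Theorem proposition2p1 (R : realType)
    (T nu : R) (hT : 0 < T) (hnu : 0 < nu)
    (V G m0 : R * R -> R)
    (hV : on_torus V) (hVb : bounded_fun V) (hG : on_torus G) (hm0 : on_torus m0)
    (F : R -> R) (hF : forall s : R, 0 < s -> derivable F s 1)
    (Nt Nh : nat) (hNt : (0 < Nt)%N) (hNh : (0 < Nh)%N)
    (Tri : set (3.-tuple (R * R))) (hTri : grid_triangulation Nh Tri)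
    (beta : 'I_Nh -> 'I_Nh -> R * R -> R) (hbeta : nodal_P1_basis Tri beta)
    (U M : 'I_Nt.+1 -> 'cV[R]_(Nh ^ 2))
    (Q : 'I_Nt -> 'I_Nh -> 'I_Nh -> R * R)
    (hF' : forall s : R, 0 < s -> 0 < derive1 F s)
    (hM : forall (k : 'I_Nt.+1) (r : 'I_(Nh ^ 2)), 0 < M k r 0) :
  let dt := T / Nt%:R in
  let sigma := Num.sqrt (2 * nu) in
  let A := bfA beta dt sigma Q in
  exists! UM : 'cV[R]_(blk_dim Nh Nt) * 'cV[R]_(blk_dim Nh Nt),
    block_mx A (- bfW F dt M) (- bfZ dt M) A^T *m col_mx UM.1 UM.2
    = col_mx (bfB F V G dt Q M) (bfC m0 dt U M).
Proof.
move=> dt sigma A; set S := block_mx _ _ _ _.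
have dt0 : 0 < dt by rewrite divr_gt0 ?ltr0n.
have uS : S \in unitmx.
  apply: saddle_unitmx => [|y|x]; first exact: bfA_unitmx.
    by apply: bfW_form_eq0 => // a r; exact/ltW/hF'.
  by apply: bfZ_form_le0 => [|a r]; exact: ltW.
(* The solution is the inverse of [S] applied to [b], cut into its two halves. *)
set b := col_mx _ _; exists (usubmx (invmx S *m b), dsubmx (invmx S *m b)).
split=> [|[x y] /= hxy]; first by rewrite /= vsubmxK mulKVmx.
by rewrite -hxy mulKmx // col_mxKu col_mxKd.
Qed.
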